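(* Let $K=\mathbb{F}_q$ be a finite field, let $S=K[t_1,\ldots,t_s]$, let $\prec$ be a monomial order on $S$, let $X$ be a subset of $\mathbb{A}^s=K^s$, let $I=I(X)$ be the vanishing ideal of $X$, let $\mathcal{L}$ be a $K$-linear subspace of $K\Delta_\prec(I)$, and let $\mathcal{L}_X$ be the standard evaluation code on $X$ relative to $\prec$. Then $$ \delta_r(\mathcal{L}_X)=\deg(S/I)-\max\{\deg(S/(I,F))\mid F\in\mathcal{L}_{\prec,r}\}\quad\mbox{for } 1\leq r\leq\dim_K(\mathcal{L}_X). $$
   Context: The vanishing ideal $I(X)$ is the set of all $f\in S$ vanishing at every point of $X$. For a monomial order $\prec$, ${\rm in}_\prec(f)$ is the initial monomial of a nonzero $f\in S$ and ${\rm in}_\prec(I)$ is the initial ideal of $I$. $\Delta_\prec(I)$ is the set of standard monomials of $S/I$, i.e. monomials not in ${\rm in}_\prec(I)$, and $K\Delta_\prec(I)$ is its $K$-span. Write $X=\{P_1,\ldots,P_m\}$ (distinct points). The evaluation map is ${\rm ev}\colon S\to K^m$, $f\mapsto(f(P_1),\ldots,f(P_m))$. For a finite-dimensional $K$-linear subspace $\mathcal{L}\subset S$, the evaluation code $\mathcal{L}_X$ is the image ${\rm ev}(\mathcal{L})$; it is called a standard evaluation code on $X$ relative to $\prec$ if $\mathcal{L}\subset K\Delta_\prec(I(X))$. $\mathcal{L}_{\prec,r}$ is the set of all subsets $F=\{f_1,\ldots,f_r\}$ of $\mathcal{L}\setminus\{0\}$ such that ${\rm in}_\prec(f_1),\ldots,{\rm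 in}_\prec(f_r)$ are distinct monomials and each $f_i$ is monic (its leading coefficient with respect to $\prec$ is $1$). $(I,F)$ is the ideal generated by $I\cup F$. For an ideal $J\subset S$, let $H_J^a(d)=\dim_K(S_{\leq d}/J_{\leq d})$, where $S_{\leq d}$, $J_{\leq d}$ are the polynomials of degree at most $d$ in $S$, $J$. If $J\subsetneq S$ and $k=\dim(S/J)$ (Krull dimension), then for $d\gg0$ $H_J^a(d)$ is a polynomial in $d$ of degree $k$ with leading coefficient $a_k$, and the degree is $\deg(S/J)=k!\,a_k$; $\deg(S/J)=0$ if $J=S$. In particular, if $k=0$, then $\deg(S/J)=\dim_K(S/J)$. For a linear code $C\subset K^m$ and $1\leq r\leq\dim_K C$, the $r$-th generalized Hamming weight is $\delta_r(C)=\min\{|\chi(D)| : D \text{ a linear subspace of } C,\ \dim_K D=r\}$, where $\chi(D)=\{i : \exists\,(a_1,\ldots,a_m)\in D,\ a_i\neq 0\}$. *)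

(* Defs.v *)
From HB Require Import structures.
From mathcomp Require Import all_boot all_order all_algebra.
From mathcomp Require Import boolp classical_sets.
From mathcomp Require Import mpoly.

Set Implicit Arguments.
Unset Strict Implicit.
Unset Printing Implicit Defensive.

Import Order.TTheory GRing.Theory Num.Theory.

Local Open Scope classical_set_scope.
Local Open Scope ring_scope.

(* Extremal elements that are required to be attained (unlike [supremum] and
   [infimum]); the value is [x0] when there is none. *)
Definition minimum (d : Order.disp_t) (T : porderType d) (x0 : T) (A : set T)
  : T := xget x0 (A `&` lbound A).

Definition maximum (d : Order.disp_t) (T : porderType d) (x0 : T) (A : set T)
  : T := xget x0 (A `&` ubound A).

Section LinearAlgebra.
Variables (K : fieldType) (V : lmodType K).

Definition linspan (A : set V) : set V :=
  [set v | exists n (c : 'I_n -> K) (a : 'I_n -> V),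
     (forall i, A (a i)) /\ v = \sum_(i < n) c i *: a i].

(* The classes of [b 0], ..., [b (n - 1)] form a basis of [U / W]; intended for
   subspaces [W `<=` U] of [V]. *)
Definition quotient_basis (U W : set V) (n : nat) (b : 'I_n -> V) : Prop :=
  [/\ forall i, U (b i),
      forall c : 'I_n -> K, W (\sum_(i < n) c i *: b i) -> forall i, c i = 0
    & forall u, U u ->
        exists c : 'I_n -> K, W (u - \sum_(i < n) c i *: b i)].

(* dim_K (U / W), when finite *)
Definition quotient_dim (U W : set V) : nat :=
  xget 0%N [set n | exists b : 'I_n -> V, quotient_basis U W b].

End LinearAlgebra.

Section Ideals.
Variables (K : fieldType) (s : nat).
Local Notation S := {mpoly K[s]}.

Definition idealgen (A : set S) : set S :=
  [set p | exists n (h a : 'I_n -> S),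
     (forall i, A (a i)) /\ p = \sum_(i < n) h i * a i].

(* [idealr_closed] already forces [1 \notin P]. *)
Definition is_prime_ideal (P : set S) : Prop :=
  idealr_closed (mem P) /\ prime_idealr_closed (mem P).

(* Krull dimension of [S / J], through the correspondence between the primes of
   [S / J] and the primes of [S] containing [J]: the largest length [k] of a
   chain P_0 < P_1 < ... < P_k of such primes. *)
Definition krull_dim (J : set S) : nat :=
  maximum 0%N [set k : nat | exists P : nat -> set S,
    (forall i, (i <= k)%N -> is_prime_ideal (P i) /\ J `<=` P i) /\
    (forall i, (i < k)%N -> P i `<` P i.+1)].

(* [msize f] is one more than the degree of [f], and [0] for [f = 0]. *)
Definition deg_le (d : nat) : set S := [set f | (msize f <= d.+1)%N].

Definition affine_hilbert_fun (J : set S) (d : nat) : nat :=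
  quotient_dim (deg_le d) (J `&` deg_le d).

Definition affine_hilbert_poly (J : set S) : {poly rat} :=
  xget 0 [set h : {poly rat} | exists N : nat, forall d : nat, (N <= d)%N ->
            h.[d%:R] = (affine_hilbert_fun J d)%:R].

(* deg (S / J) *)
Definition quotient_degree (J : set S) : rat :=
  let k := krull_dim J in
  if `[< J = setT >] then 0 else (k`!)%:R * (affine_hilbert_poly J)`_k.

End Ideals.

Section MonomialOrder.
Variable s : nat.

Definition is_monomial_order (le : rel 'X_{1..s}) : Prop :=
  [/\ reflexive le, antisymmetric le, transitive le & total le] /\
  [/\ forall m, le 0%MM m
    & forall m1 m2 m, le m1 m2 -> le (m1 + m)%MM (m2 + m)%MM].

Variables (K : fieldType) (le : rel 'X_{1..s}).
Local Notation S := {mpoly K[s]}.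

(* The [le]-largest monomial of the support of [f]: [0%MM] is [le]-least, hence
   neutral. This is [mlead] for an arbitrary monomial order. *)
Definition initmon (f : S) : 'X_{1..s} :=
  \big[(fun m1 m2 => if le m1 m2 then m2 else m1) / 0%MM]_(m <- msupp f) m.

Definition initcoef (f : S) : K := f@_(initmon f).

Definition initial_ideal (J : set S) : set S :=
  idealgen [set 'X_[initmon f] | f in [set f : S | J f /\ f != 0]].

Definition standard_monomials (J : set S) : set 'X_{1..s} :=
  [set m | ~ initial_ideal J 'X_[m]].

Definition standard_span (J : set S) : set S :=
  linspan [set 'X_[m] | m in standard_monomials J].

(* Distinctness of the initial monomials makes [range f] an [r]-element set. *)
Definition monic_subsets (L : set S) (r : nat) : set (set S) :=
  [set F | exists f : 'I_r -> S,
     [/\ F = range f,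
         forall i, L (f i) /\ f i != 0,
         injective (fun i => initmon (f i))
       & forall i, initcoef (f i) = 1]].

End MonomialOrder.

Section Codes.
Variable K : finFieldType.

Definition vanishing_ideal (s : nat) (X : {set 'rV[K]_s}) : set {mpoly K[s]} :=
  [set f | forall P, P \in X -> f.@[fun i => P 0 i] = 0].

(* The points of [X] are numbered by [enum_val]. *)
Definition ev (s : nat) (X : {set 'rV[K]_s}) (f : {mpoly K[s]}) : 'rV[K]_#|X| :=
  \row_(i < #|X|) f.@[fun j => (enum_val i : 'rV[K]_s) 0 j].

(* The subspace of [K^m] whose underlying set is the image [ev(L)]; it exists
   as soon as [L] is a linear subspace. *)
Definition eval_code (s : nat) (X : {set 'rV[K]_s}) (L : set {mpoly K[s]})
  : {vspace 'rV[K]_#|X|} :=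
  xget 0%VS [set C : {vspace 'rV[K]_#|X|} | [set` C] = ev X @` L].

Definition code_support (m : nat) (D : {vspace 'rV[K]_m}) : pred 'I_m :=
  [pred i | [exists a : 'rV[K]_m, (a \in D) && (a 0 i != 0)]].

Definition gen_hamming_weight (m : nat) (C : {vspace 'rV[K]_m}) (r : nat)
  : nat :=
  minimum 0%N [set #|code_support D| | D in
    [set D : {vspace 'rV[K]_m} | (D <= C)%VS /\ \dim D = r]].

End Codes.

(* Main.v *)
(* Since [S / I(X)] is the ring of functions on the finite set [X], every ideal
   containing [I(X)] is the vanishing ideal of a subset [V] of [X]; such an
   ideal has dimension [0] and degree [#|V|].  Hence [deg (S / (I, F))] is the
   number of common zeros of [F] in [X], that is, [#|X|] minus the support size
   of the span of [ev(F)].  Evaluation is injective on standard polynomials, so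
   these spans, for [F] ranging over the monic subsets, are exactly the
   [r]-dimensional subcodes: polynomials with distinct initial monomials are
   independent, and an [r]-dimensional space of polynomials has [r] distinct
   initial monomials. *)

Require Import Defs.
From mathcomp Require Import all_boot all_order all_algebra.
From mathcomp Require Import boolp classical_sets finfield.
From mathcomp Require Import mpoly.

Import Order.TTheory GRing.Theory Num.Theory.

Local Open Scope classical_set_scope.
Local Open Scope ring_scope.

Set Implicit Arguments.
Unset Strict Implicit.
Unset Printing Implicit Defensive.

(** * Attained minima and maxima *)

Section Extrema.
Variables (d : Order.disp_t) (T : porderType d) (x0 : T) (A : set T).

Lemma minimumE x : A x -> lbound A x -> minimum x0 A = x.
Proof.
move=> Ax lbx; apply: xget_unique => // y [Ay lby].
by apply: le_anti; rewrite lbx // lby.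
Qed.

Lemma maximumE x : A x -> ubound A x -> maximum x0 A = x.
Proof.
move=> Ax ubx; apply: xget_unique => // y [Ay uby].
by apply: le_anti; rewrite ubx // uby.
Qed.

End Extrema.

Lemma exists_least_nat (A : set nat) :
  A !=set0 -> exists2 n, A n & lbound A n.
Proof.
move=> [n An]; have exA : exists n, `[< A n >] by exists n; apply/asboolP.
case: (ex_minnP exA) => m /asboolP Am lem; exists m => // k Ak.
by rewrite leEnat lem //; apply/asboolP.
Qed.

(** * Closure properties of generated ideals *)

Section Ideals.
Variables (K : fieldType) (s : nat).
Implicit Type A : set {mpoly K[s]}.

Lemma idealgen_sub A : A `<=` idealgen A.
Proof.
move=> f Af; exists 1%N, (fun=> 1), (fun=> f); split=> //.
by rewrite big_ord1 mul1r.
Qed.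

Lemma idealgenD A f g : idealgen A f -> idealgen A g -> idealgen A (f + g).
Proof.
move=> [n1 [h1 [a1 [Aa1 ->]]]] [n2 [h2 [a2 [Aa2 ->]]]].
exists (n1 + n2)%N.
exists (fun i => match split i with inl j => h1 j | inr j => h2 j end).
exists (fun i => match split i with inl j => a1 j | inr j => a2 j end).
split=> [i|]; first by case: (split i).
rewrite big_split_ord; congr (_ + _); apply: eq_bigr => i _.
  by rewrite (unsplitK (inl i)).
by rewrite (unsplitK (inr i)).
Qed.

Lemma idealgenM A p f : idealgen A f -> idealgen A (p * f).
Proof.
move=> [n [h [a [Aa ->]]]]; exists n, (fun i => p * h i), a; split=> //.
by rewrite mulr_sumr; apply: eq_bigr => i _; rewrite mulrA.
Qed.

End Ideals.

(** * Ideals containing a vanishing ideal, and their degree *)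

Section VanishingIdeals.
Variables (K : finFieldType) (s : nat).
Local Notation S := {mpoly K[s]}.
Implicit Types (P Q : 'rV[K]_s) (f g : S) (V X : {set 'rV[K]_s}) (J : set S).

Definition evalat P f : K := f.@[fun i => P 0 i].

Lemma evalatB P f g : evalat P (f - g) = evalat P f - evalat P g.
Proof. exact: mevalB. Qed.

Lemma evalatM P f g : evalat P (f * g) = evalat P f * evalat P g.
Proof. exact: mevalM. Qed.

Lemma evalatZ P c f : evalat P (c *: f) = c * evalat P f.
Proof. exact: mevalZ. Qed.

Lemma evalat1 P : evalat P 1 = 1.
Proof. exact: meval1. Qed.

Lemma evalat_sum P (I : Type) (r : seq I) (p : pred I) (F : I -> S) :
  evalat P (\sum_(i <- r | p i) F i) = \sum_(i <- r | p i) evalat P (F i).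
Proof. exact: raddf_sum. Qed.

(** The indicator function of [P] as a polynomial: each factor is 1 or 0 according to whether the
    i-th coordinate agrees with that of [P], because a nonzero x in K satisfies x^(q-1) = 1. *)
Definition point_poly P : S :=
  \prod_(i < s) (1 - ('X_i - (P 0 i)%:MP) ^+ #|K|.-1).

Lemma expf_card_pred (x : K) : x ^+ #|K|.-1 = (x != 0)%:R.
Proof.
(* The exponent must be positive, for otherwise the case x = 0 would read 0^0 = 1. *)
have K1 := card_finNzRing_gt1 K.
have [->|x0] := eqVneq x 0.
  by rewrite expr0n -(subnKC K1).
apply: (mulfI x0); rewrite -exprS prednK ?expf_card ?mulr1 //.
exact: ltnW.
Qed.

Lemma evalat_point P Q : evalat Q (point_poly P) = (Q == P)%:R.
Proof.
rewrite /evalat rmorph_prod /=.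
under eq_bigr => i _ do
  rewrite mevalB meval1 rmorphXn /= mevalB mevalXU mevalC expf_card_pred.
have [->|] := eqVneq Q P.
  by rewrite big1 // => i _; rewrite subrr eqxx subr0.
move/eqP => QP; have [i Qi] : exists i, Q 0 i != P 0 i.
  apply: contra_notP QP => /forallNP eqQ; apply/rowP => i.
  by apply/eqP; have /negP := eqQ i; rewrite negbK.
by rewrite (bigD1 i) //= subr_eq0 Qi subrr mul0r.
Qed.

Definition common_zeros X J : {set 'rV[K]_s} :=
  [set P in X | `[< forall f, J f -> evalat P f = 0 >]].

Lemma ideal_sum J (I : Type) (r : seq I) (p : pred I) (F : I -> S) : J 0 ->
  (forall f g, J f -> J g -> J (f + g)) ->
  (forall i, p i -> J (F i)) -> J (\sum_(i <- r | p i) F i).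
Proof. by move=> J0 JD JF; elim/big_ind : _. Qed.

(** Interpolation: a polynomial vanishing on the common zeros of [J] agrees on [X] with some element
    of [J], hence differs from it by an element of I(X), which also lies in [J]. *)
Lemma ideal_above_vanishing J X :
  (forall f g, J f -> J g -> J (f + g)) ->
  (forall h f, J f -> J (h * f)) ->
  vanishing_ideal X `<=` J ->
  J = vanishing_ideal (common_zeros X J).
Proof.
move=> JD JM IJ; apply/seteqP; split=> f.
  by move=> Jf P; rewrite inE => /andP[_ /asboolP]; apply.
have J0 : J 0 by apply: IJ => P _; rewrite meval0.
set V := common_zeros X J => IVf.
have /choice[g gP] : forall P, exists g, P \in X -> P \notin V ->
    J g /\ evalat P g != 0.
  move=> P; have [PX|PX] := boolP (P \in X); last by exists 0.
  have [PV|] := boolP (P \in V); first by exists 0.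
  rewrite inE PX /= => /asboolPn /existsNP[g /not_implyP[Jg /eqP gP]].
  by exists g.
(* At a point [Q] of [X] outside [V] only the summand of [Q] survives, and the scalar makes its
   value that of [f]; on [V] both [F] and [f] vanish. *)
pose F := \sum_(P in X | P \notin V)
  (evalat P f / evalat P (g P)) *: point_poly P * g P.
have JF : J F.
  by apply: ideal_sum => // P /andP[PX PV]; apply: JM; case: (gP P PX PV).
rewrite -(subrK F f); apply: JD => //; apply: IJ => Q QX.
rewrite -/(evalat Q _) evalatB evalat_sum.
under eq_bigr => P _ do rewrite evalatM evalatZ evalat_point.
have [QV|QV] := boolP (Q \in V).
  rewrite [evalat Q f]IVf // big1 ?subrr // => P /andP[_ PV].
  by case: eqVneq => [QP|_]; [rewrite QP (negPf PV) in QV | rewrite mulr0 mul0r].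
rewrite (bigD1 Q) ?QX //= eqxx mulr1 big1.
  by rewrite addr0 divfK ?subrr //; case: (gP Q QX QV).
by move=> P /andP[_ PQ]; rewrite eq_sym (negPf PQ) mulr0 mul0r.
Qed.

(** The zero set is nonempty because 1 is not in [J]. With two distinct zeros P and Q, the indicator
    e of P would give e(1 - e) in [J], although e is nonzero at P and 1 - e at Q. *)
Lemma prime_above_vanishing J X : is_prime_ideal J -> vanishing_ideal X `<=` J ->
  exists P, J = vanishing_ideal [set P].
Proof.
move=> [[J0 J1 Jlin] Jprime] IJ.
have JM h f : J f -> J (h * f).
  by move=> Jf; have := Jlin h f 0; rewrite addr0 !in_setE in J0 *; apply.
have JD f g : J f -> J g -> J (f + g).
  by move=> Jf Jg; have := Jlin 1 f g; rewrite mul1r !in_setE; apply.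
have := ideal_above_vanishing JD JM IJ; set V := common_zeros X J => JE.
have [V0|[P PV]] := set_0Vmem V.
  case/negP: J1; rewrite in_setE JE V0 => Q; by rewrite inE.
exists P; rewrite JE; congr vanishing_ideal.
suff VP Q : Q \in V -> Q = P.
  by apply/setP => Q; rewrite finset.in_set1; apply/idP/eqP => [/VP|->].
move=> QV; apply/eqP/negPn/negP => QP.
have : point_poly P * (1 - point_poly P) \in J.
  rewrite in_setE JE => R _.
  rewrite -/(evalat _ _) evalatM evalatB evalat1 evalat_point.
  by case: (R == P); rewrite ?subrr ?mulr0 ?mul0r.
move=> /Jprime /orP[]; rewrite in_setE JE.
  move=> /(_ _ PV) /eqP; rewrite -/(evalat _ _) evalat_point eqxx.
  by rewrite (negPf (oner_neq0 _)).
move=> /(_ _ QV) /eqP; rewrite -/(evalat _ _) evalatB evalat1 evalat_point.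
by rewrite (negPf QP) subr0 (negPf (oner_neq0 _)).
Qed.

(** The primes above the ideal are ideals of single points, which are pairwise incomparable: the
    indicator of one point vanishes at every other. *)
Lemma krull_dim_vanishing V : krull_dim (vanishing_ideal V) = 0%N.
Proof.
(* The value is either the default 0, as for empty [V], where no prime contains the ideal, or the
   length of a chain, and only positive lengths need refuting. *)
rewrite /krull_dim /maximum; case: xgetP => [[//|k] _ [[P [Pp Plt]] _]|//].
have [p0 I0] := Pp 0%N isT; have [p1 I1] := Pp 1%N isT.
have [Q0 E0] := prime_above_vanishing p0 I0.
have [Q1 E1] := prime_above_vanishing p1 I1.
have := Plt 0%N isT; rewrite E0 E1 => -[sub nsub].
exfalso; suff eqQ : Q0 = Q1 by apply: nsub; rewrite eqQ.
apply/eqP/negPn/negP => Q01.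
have /sub/(_ Q1) : vanishing_ideal [set Q0] (point_poly Q1).
  move=> R; rewrite finset.in_set1 => /eqP ->.
  by rewrite -/(evalat _ _) evalat_point (negPf Q01).
rewrite finset.in_set1 eqxx => /(_ isT) /eqP; rewrite -/(evalat _ _) evalat_point eqxx.
by rewrite (negPf (oner_neq0 _)).
Qed.

(** A degree from which on all indicators are available, so that the Hilbert function is
    constant. *)
Definition point_size : nat := \max_(P : 'rV[K]_s) msize (point_poly P).

Lemma affine_hilbert_fun_vanishing V d : (point_size <= d)%N ->
  affine_hilbert_fun (vanishing_ideal V) d = #|V|.
Proof.
move=> led; have ptd P : (msize (point_poly P) <= d.+1)%N.
  by apply: leqW; apply: leq_trans led; exact: leq_bigmax.
have lincombd n (c : 'I_n -> K) (b : 'I_n -> S) :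
    (forall i, deg_le d (b i)) -> deg_le d (\sum_i c i *: b i).
  move=> bd; rewrite /deg_le /=; apply: (leq_trans (msize_sum _ _ _)).
  apply/bigmax_leqP => i _; exact: leq_trans (msizeZ_le _ _) (bd i).
rewrite /affine_hilbert_fun /quotient_dim; apply: xget_unique.
  (* The indicators of the points of [V] form a basis of the quotient, with the values at these
     points as coordinates. *)
  exists (fun i => point_poly (enum_val i)); split=> [i|c [cV _] i|u ud].
  - exact: ptd.
  - have := cV (enum_val i) (enum_valP i).
    rewrite -/(evalat _ _) evalat_sum (bigD1 i) //= evalatZ evalat_point eqxx.
    rewrite mulr1 big1 ?addr0 // => j ji; rewrite evalatZ evalat_point.
    by rewrite (inj_eq enum_val_inj) eq_sym (negPf ji) mulr0.
  - exists (fun i => evalat (enum_val i) u); split; last first.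
      apply: leq_trans (msizeD_le _ _) _; rewrite msizeN geq_max ud /=.
      by apply: lincombd => i; exact: ptd.
    move=> P PV; rewrite -/(evalat _ _) evalatB evalat_sum.
    rewrite -(enum_rankK_in PV PV); set i0 := enum_rank_in _ _.
    rewrite (bigD1 i0) //= evalatZ evalat_point eqxx mulr1 big1 ?addr0 ?subrr //.
    move=> j ji; rewrite evalatZ evalat_point.
    by rewrite (inj_eq enum_val_inj) eq_sym (negPf ji) mulr0.
move=> n [b [bd bfree bgen]].
(* Every other basis has the same length: independence makes its matrix of values on [V] row free,
   and generation of the indicators makes it row full. *)
pose M := \matrix_(i < n, j < #|V|) evalat (enum_val j) (b i).
have ME (c : 'rV_n) j : (c *m M) 0 j =
    evalat (enum_val j) (\sum_i c 0 i *: b i).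
  by rewrite mxE evalat_sum; apply: eq_bigr => i _; rewrite mxE evalatZ.
have : row_free M.
  rewrite -kermx_eq0; apply/eqP/row_matrixP => i; rewrite row0.
  set c := row i _; have cM : c *m M = 0 by rewrite -row_mul mulmx_ker row0.
  apply/rowP => j; rewrite [RHS]mxE; apply: (bfree (c 0)); split.
    move=> P PV; rewrite -/(evalat _ _) -(enum_rankK_in PV PV) -ME cM.
    by rewrite mxE.
  exact: lincombd.
have : row_full M.
  rewrite -sub1mx; apply/row_subP => j; rewrite rowE mulmx1.
  have [c [cV _]] := bgen _ (ptd (enum_val j)).
  apply/submxP; exists (\row_i c i); apply/rowP => k; rewrite ME.
  have /eqP := cV (enum_val k) (enum_valP k).
  rewrite -/(evalat _ _) evalatB subr_eq0 evalat_point (inj_eq enum_val_inj).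
  rewrite mxE /= => /eqP ->; rewrite !evalat_sum.
  by apply: eq_bigr => i _; rewrite mxE.
by move=> /eqP rV /eqP rn; exact: etrans (esym rn) rV.
Qed.

Lemma quotient_degree_vanishing V : quotient_degree (vanishing_ideal V) = #|V|%:R.
Proof.
rewrite /quotient_degree krull_dim_vanishing fact0 mul1r.
(* For empty [V] the ideal is the whole ring, whose degree is 0 by convention. *)
have [->|[P PV]] := set_0Vmem V.
  rewrite asboolT ?cards0 //; apply/seteqP; split=> // f _ P.
  by rewrite finset.in_set0.
rewrite asboolF; last first.
  move=> VT; have : vanishing_ideal V 1 by rewrite VT.
  move=> /(_ _ PV)/eqP; rewrite -/(evalat _ _) evalat1.
  by rewrite (negPf (oner_neq0 _)).
rewrite /affine_hilbert_poly (@xget_unique _ _ _ (#|V|%:R)%:P) ?coefC //.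
  by exists point_size => d led; rewrite hornerC affine_hilbert_fun_vanishing.
move=> h [N hN]; apply/eqP; rewrite -subr_eq0; apply/eqP.
(* Past both thresholds [h] takes the constant value #|V|; as many distinct roots as the size of the
   difference force it to be 0. *)
pose r : seq rat := [seq i%:R | i <- iota (maxn N point_size) (size (h - (#|V|%:R)%:P))].
apply: (@roots_geq_poly_eq0 _ _ r).
- apply/allP => _ /mapP[i + ->]; rewrite mem_iota geq_max => /andP[/andP[Ni si] _].
  by rewrite rootE !hornerE hN // affine_hilbert_fun_vanishing // subrr.
- by rewrite map_inj_uniq ?iota_uniq //; exact: (mulrIn (oner_neq0 _)).
- by rewrite size_map size_iota.
Qed.

(** On [X] the generators from I(X) vanish anyway, so the zeros of the generated ideal there are
    those of [F]. *)
Lemma quotient_degree_idealgen X (F : set S) :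
  quotient_degree (idealgen (vanishing_ideal X `|` F)) =
  #|common_zeros X F|%:R.
Proof.
rewrite (@ideal_above_vanishing (idealgen _) X).
- rewrite quotient_degree_vanishing; congr (_%:R); apply: eq_card => P.
  rewrite !inE; case PX: (P \in X) => //=; apply: asbool_equiv_eq; split.
    by move=> H f Ff; apply/H/idealgen_sub; right.
  move=> H f [n [h [a [aA ->]]]]; rewrite evalat_sum big1 // => i _.
  rewrite evalatM; case: (aA i) => [Ia|/H->]; last by rewrite mulr0.
  by rewrite [evalat P (a i)]Ia ?mulr0.
- exact: idealgenD.
- exact: idealgenM.
- by move=> f If; apply: idealgen_sub; left.
Qed.

End VanishingIdeals.

(** * Initial monomials and standard polynomials *)

Section InitialMonomials.
Variables (K : fieldType) (s : nat) (le : rel 'X_{1..s}).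
Hypothesis hle : is_monomial_order le.
Local Notation S := {mpoly K[s]}.
Implicit Types (f g : S) (J : set S).

Lemma initmon_max f m : m \in msupp f -> le m (initmon le f).
Proof.
case: hle => -[le_refl _ le_trans le_total] _.
rewrite /initmon; elim: (msupp f : seq _) => // a t IH; rewrite inE big_cons.
set b := \big[_/_]_(_ <- t) _ in IH *.
case/predU1P => [->|/IH mb]; first by case: ifP => // _; exact: le_refl.
case: ifP => // /negbT nab; apply: le_trans mb _.
by have := le_total a b; rewrite (negPf nab).
Qed.

Lemma initmon_msupp f : f != 0 -> initmon le f \in msupp f.
Proof.
case: hle => -[_ le_anti _ _] [le0 _].
move=> f0; have := @initmon_max f.
have : initmon le f \in 0%MM :: msupp f.
  rewrite /initmon; elim: (msupp f : seq _) => [|a t IH].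
    by rewrite big_nil mem_head.
  rewrite big_cons; case: ifP => _; last by rewrite !inE eqxx orbT.
  by move: IH; rewrite !inE => /orP[->|->]; rewrite ?orbT.
(* If the fold returns its neutral value [0%MM], every monomial of the nonempty support is below it,
   hence equal to it. *)
case/predU1P => // -> max0; case: (msupp f) (msupp_eq0 f) max0 => [|a t].
  by rewrite eqxx (negPf f0).
move=> _ /(_ a (mem_head _ _)) lea0.
by rewrite (le_anti 0%MM a) ?mem_head // le0.
Qed.

Lemma initmon_eq f m : m \in msupp f -> (forall k, k \in msupp f -> le k m) ->
  initmon le f = m.
Proof.
case: hle => -[_ le_anti _ _] _ mf maxm; apply: le_anti.
rewrite initmon_max // andbT maxm // initmon_msupp //.
by rewrite -msupp_eq0; apply: contraTneq mf => ->.
Qed.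

Lemma initmonZ c f : c != 0 -> f != 0 -> initmon le (c *: f) = initmon le f.
Proof.
move=> c0 f0; have suppZ := perm_mem (msuppZ f c0).
apply: initmon_eq => [|m]; rewrite suppZ; first exact: initmon_msupp.
exact: initmon_max.
Qed.

Lemma initcoef_neq0 f : f != 0 -> initcoef le f != 0.
Proof. by move=> /initmon_msupp; rewrite mcoeff_msupp. Qed.

(** Among the indices with nonzero coefficient, take the one with the largest initial monomial: no
    other term of the sum can cancel that monomial. *)
Lemma initmon_free n (f : 'I_n -> S) (c : 'I_n -> K) :
  (forall i, initcoef le (f i) = 1) -> injective (fun i => initmon le (f i)) ->
  \sum_i c i *: f i = 0 -> forall i, c i = 0.
Proof.
case: (hle) => -[le_refl le_anti le_trans le_total] _ f1 finj sum0 i0.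
apply/eqP/negPn/negP => ci0.
(* [extremumP] yields a least element, so the order is reversed to obtain a largest one. *)
pose ge := [rel m k | le k m].
have [] := @extremumP _ _ ge i0 [pred i | c i != 0] (fun i => initmon le (f i)).
- exact: le_refl.
- by move=> a b d /= ba /le_trans; apply.
- by move=> a b; exact: le_total.
- exact: ci0.
move=> i /= ci imax; have := congr1 (mcoeff (initmon le (f i))) sum0.
rewrite raddf_sum mcoeff0 (bigD1 i) //= mcoeffZ [_@__]f1 mulr1 big1.
  by rewrite addr0 => /eqP; rewrite (negPf ci).
move=> j ji; rewrite mcoeffZ; have [->|cj] := eqVneq (c j) 0; rewrite ?mul0r //.
case: (boolP (initmon le (f i) \in msupp (f j))) => [/initmon_max ij|].
  case/eqP: ji; apply: finj; apply: le_anti; rewrite ij andbT.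
  exact: imax.
by move/memN_msupp_eq0 => ->; rewrite mulr0.
Qed.

(** The initial monomial of a nonzero [f] in [J] is not standard, yet it would occur among standard
    monomials. For J = I(X) this makes evaluation injective on standard polynomials. *)
Lemma standard_span_eq0 J f : standard_span le J f -> J f -> f = 0.
Proof.
move=> [n [c [a [astd fE]]]] Jf; apply/eqP/negPn/negP => f0.
have := initmon_msupp f0; set m := initmon le f => mf.
have [i aim] : exists i, (a i)@_m != 0.
  apply: contraTP mf => /forallNP ai0.
  rewrite mcoeff_msupp fE raddf_sum big1 ?eqxx // => i _ /=.
  by rewrite mcoeffZ; have /negP/negPn/eqP -> := ai0 i; rewrite mulr0.
have [k kstd ak] := astd i.
move: aim; rewrite -ak mcoeffX; have [km|] := eqVneq k m; last by rewrite eqxx.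
by case: kstd; rewrite km; apply: idealgen_sub; exists f.
Qed.

End InitialMonomials.

(** * Evaluation codes and the supports of their subcodes *)

Lemma exists_vspace (K : finFieldType) m (A : set 'rV[K]_m) :
  submod_closed (mem A) -> exists C : {vspace 'rV[K]_m}, [set` C] = A.
Proof.
(* Since [K] is finite, all vectors of [A] can be listed as generators. *)
move=> [A0 Alin]; exists <<enum [pred v | v \in A]>>%VS.
apply/seteqP; split=> v /=; last first.
  by move=> Av; apply: memv_span; rewrite mem_enum; exact: mem_set.
move=> /(@coord_span _ _ _ (in_tuple _)) ->; rewrite -in_setE.
elim/big_ind: _ => // [x y xA yA|i _].
  by have := Alin 1 x y xA yA; rewrite scale1r.
rewrite -[_ *: _]addr0; apply: Alin => //=.
by have := mem_nth 0 (ltn_ord i); rewrite mem_enum inE.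
Qed.

Section Codes.
Variables (K : finFieldType) (s : nat) (X : {set 'rV[K]_s}).
Local Notation S := {mpoly K[s]}.

Lemma evE f i : ev X f 0 i = evalat (enum_val i) f.
Proof. by rewrite mxE. Qed.

Lemma ev_lincomb n (c : 'I_n -> K) (f : 'I_n -> S) :
  ev X (\sum_i c i *: f i) = \sum_i c i *: ev X (f i).
Proof.
apply/rowP => j; rewrite evE evalat_sum summxE; apply: eq_bigr => i _.
by rewrite mxE evE evalatZ.
Qed.

Lemma ev_eq0 f : ev X f = 0 -> vanishing_ideal X f.
Proof.
move=> ef P PX; have := congr1 (fun v : 'rV_ _ => v 0 (enum_rank_in PX P)) ef.
by rewrite evE mxE enum_rankK_in.
Qed.

Lemma mem_eval_code (L : set S) : submod_closed (mem L) ->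
  [set` eval_code X L] = ev X @` L.
Proof.
move=> [L0 Llin]; apply: (@xgetPex _ _ [set C : {vspace _} | [set` C] = _]).
apply: exists_vspace; split=> [|a u v]; rewrite !in_setE.
  exists 0; first by rewrite -in_setE.
  by apply/rowP => i; rewrite evE mxE /evalat meval0.
move=> [f Lf <-] [g Lg <-]; exists (a *: f + g).
  by rewrite -in_setE; apply: Llin; rewrite in_setE.
by apply/rowP => i; rewrite !mxE mevalD mevalZ.
Qed.

(** A coordinate lies outside the support of a span exactly when all generators vanish there, that
    is, when its point is a common zero. *)
Lemma card_code_support r (f : 'I_r -> S) :
  (#|code_support <<[tuple ev X (f i) | i < r]>>| + #|common_zeros X (range f)|
     = #|X|)%N.
Proof.
set D := <<_>>%VS; rewrite -[RHS]card_ord -(cardC (code_support D)); congr addn.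
rewrite -(card_imset _ enum_val_inj); apply: eq_card => P.
have suppP i : (i \notin code_support D) = (enum_val i \in common_zeros X (range f)).
  rewrite !inE enum_valP /= negb_exists; apply/forallP/asboolP => [H _ [j _ <-]|].
    have := H (ev X (f j)); rewrite evE negb_and negbK memv_span /=.
      by move/eqP.
    by rewrite -(tnth_mktuple (fun i => ev X (f i)) j) mem_tnth.
  move=> H a; rewrite negb_and negbK orbC; case: eqVneq => //= ai.
  apply: contra ai => /coord_span ->; rewrite summxE big1 // => j _.
  by rewrite mxE -tnth_nth tnth_mktuple evE H ?mulr0 //; exists j.
apply/idP/imsetP => [PZ|[i + ->]]; last by rewrite inE suppP.
have PX : P \in X by move: PZ; rewrite inE => /andP[].
exists (enum_rank_in PX P); last by rewrite enum_rankK_in.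
by rewrite inE suppP enum_rankK_in.
Qed.

(** * Correspondence between monic subsets and subcodes *)

Variables (le : rel 'X_{1..s}) (L : set S).
Hypotheses (hle : is_monomial_order le) (hLsub : submod_closed (mem L)).
Hypothesis hLstd : L `<=` standard_span le (vanishing_ideal X).

Lemma submod_lincomb n (c : 'I_n -> K) (f : 'I_n -> S) :
  (forall i, L (f i)) -> L (\sum_i c i *: f i).
Proof.
case: hLsub => L0 Llin Lf; rewrite -in_setE.
elim/big_ind: _ => // [x y xL yL|i _].
  by have := Llin 1 x y xL yL; rewrite scale1r.
by rewrite -[_ *: _]addr0; apply: Llin => //; rewrite in_setE.
Qed.

(** A relation among the evaluations gives a standard polynomial vanishing on [X], hence zero, and
    distinct initial monomials then make the relation trivial. *)
Lemma monic_span r (f : 'I_r -> S) : (forall i, L (f i)) ->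
  (forall i, initcoef le (f i) = 1) -> injective (fun i => initmon le (f i)) ->
  let D := <<[tuple ev X (f i) | i < r]>>%VS in
  (D <= eval_code X L)%VS /\ \dim D = r.
Proof.
move=> Lf f1 finj D; split.
  apply/span_subvP => _ /tnthP[i ->]; rewrite tnth_mktuple.
  have : (ev X @` L) (ev X (f i)) by exists (f i).
  by rewrite -mem_eval_code.
suff : free [tuple ev X (f i) | i < r] by move/eqP; rewrite size_tuple.
apply/freeP => c sum0; apply: (initmon_free hle f1 finj).
apply: (standard_span_eq0 hle (hLstd (submod_lincomb c Lf))).
apply: ev_eq0; rewrite ev_lincomb -[RHS]sum0; apply: eq_bigr => i _.
by rewrite -tnth_nth tnth_mktuple.
Qed.

(* If the initial monomials of the polynomials evaluating into [D] were fewer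
   than [\dim D], a nonzero such polynomial would have zero coefficients at all
   of them, its own initial monomial included. *)
Lemma exists_new_initmon (D : {vspace 'rV[K]_#|X|}) (ms : seq 'X_{1..s}) :
  (D <= eval_code X L)%VS -> (size ms < \dim D)%N ->
  exists f, [/\ L f, ev X f \in D, f != 0 & initmon le f \notin ms].
Proof.
move=> DC ltms.
have /choice[b bP] : forall i : 'I_(\dim D), exists f, L f /\ ev X f = (vbasis D)`_i.
  move=> i; have /(subvP DC) : (vbasis D)`_i \in D.
    by apply/vbasis_mem/mem_nth; rewrite size_tuple.
  have := mem_eval_code hLsub => /seteqP[+ _] vC.
  by move=> /(_ _ vC)[f Lf fE]; exists f.
pose M := \matrix_(i < \dim D, j < size ms) (b i)@_(nth 0%MM ms j).
have : kermx M != 0.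
  rewrite kermx_eq0 /row_free neq_ltn (leq_ltn_trans (rank_leq_col M)) //.
case/rowV0Pn => c /sub_kermxP cM c0; pose f := \sum_i c 0 i *: b i.
have evf : ev X f = \sum_i c 0 i *: (vbasis D)`_i.
  by rewrite ev_lincomb; apply: eq_bigr => i _; case: (bP i) => _ ->.
exists f.
have f0 : f != 0.
  apply: contra c0 => /eqP f0; apply/eqP/rowP => i; rewrite [RHS]mxE.
  have /freeP := basis_free (vbasisP D); apply; rewrite -evf f0.
  by apply/rowP => j; rewrite evE mxE /evalat meval0.
split=> //.
- by apply: submod_lincomb => i; case: (bP i).
- rewrite evf; apply: memv_suml => i _; apply/memvZ/vbasis_mem/mem_nth.
  by rewrite size_tuple.
apply: contraTN (initmon_msupp hle f0) => /(nthP 0%MM)[j ltj <-].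
rewrite mcoeff_msupp negbK raddf_sum /=.
have := congr1 (fun v : 'rV_ _ => v 0 (Ordinal ltj)) cM; rewrite !mxE => {2}<-.
by apply/eqP/eq_bigr => i _; rewrite mcoeffZ mxE.
Qed.

(** Converse of [monic_span]: new initial monomials are collected until there are [\dim D] of them,
    and the span of the resulting evaluations fills [D] by dimension. *)
Lemma exists_monic_basis (D : {vspace 'rV[K]_#|X|}) : (D <= eval_code X L)%VS ->
  exists f : 'I_(\dim D) -> S,
    [/\ forall i, L (f i), forall i, initcoef le (f i) = 1,
        injective (fun i => initmon le (f i))
      & D = <<[tuple ev X (f i) | i < \dim D]>>%VS].
Proof.
move=> DC.
pose good m f := [/\ L f, ev X f \in D, initcoef le f = 1 & initmon le f = m].
have [ms [sms ums msP]] : exists ms : seq 'X_{1..s},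
    [/\ size ms = \dim D, uniq ms & forall m, m \in ms -> exists f, good m f].
  (* The induction is on the length of the list, kept at most [\dim D], while [D] stays fixed. *)
  elim: {1 3}(\dim D) (leqnn (\dim D)) => [_|k IH ltk]; first by exists [::].
  have [ms [sms ums msP]] := IH (ltnW ltk).
  have [|f [Lf fD f0 fms]] := exists_new_initmon (ms := ms) DC.
    by rewrite sms.
  exists (initmon le f :: ms); split=> /=; [by rewrite sms | by rewrite fms |].
  move=> m; rewrite inE => /predU1P[->|/msP//].
  have c0 := initcoef_neq0 hle f0.
  exists ((initcoef le f)^-1 *: f); have cV0 := invr_neq0 c0; split.
  - have := submod_lincomb (fun=> (initcoef le f)^-1) (fun _ : 'I_1 => Lf).
    by rewrite big_ord1.
  - have := ev_lincomb (fun=> (initcoef le f)^-1) (fun _ : 'I_1 => f).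
    by rewrite !big_ord1 => ->; exact: memvZ.
  - by rewrite /initcoef initmonZ // mcoeffZ mulVf.
  - exact: initmonZ.
have /choice[f fP] : forall i : 'I_(\dim D), exists f, good (nth 0%MM ms i) f.
  by move=> i; apply/msP/mem_nth; rewrite sms.
have Lf i : L (f i) by case: (fP i).
have f1 i : initcoef le (f i) = 1 by case: (fP i).
have finj : injective (fun i => initmon le (f i)).
  move=> i j /=; case: (fP i) => _ _ _ ->; case: (fP j) => _ _ _ ->.
  by move=> /eqP; rewrite nth_uniq ?sms // => /eqP/val_inj.
exists f; split=> //; apply/esym/eqP.
rewrite eqEdim; have [_ ->] := monic_span Lf f1 finj; rewrite leqnn andbT.
by apply/span_subvP => _ /tnthP[i ->]; rewrite tnth_mktuple; case: (fP i).
Qed.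

End Codes.

(** * Minimal support against maximal number of common zeros *)

Theorem theorem3p4 (K : finFieldType) (s : nat) (le : rel 'X_{1..s})
    (hle : is_monomial_order le) (X : {set 'rV[K]_s}) (L : set {mpoly K[s]})
    (hLsub : submod_closed (mem L))
    (hLstd : L `<=` standard_span le (vanishing_ideal X))
    (r : nat) (hr : (1 <= r <= \dim (eval_code X L))%N) :
  (gen_hamming_weight (eval_code X L) r)%:R =
    quotient_degree (vanishing_ideal X) -
    maximum 0 [set quotient_degree (idealgen (vanishing_ideal X `|` F)) |
                 F in monic_subsets le L r].
Proof.
set C := eval_code X L.
have [_ rC] := andP hr.
have [w [D0 [D0C dimD0] wE] wmin] : exists2 w,
    [set #|code_support D| | D in
      [set D : {vspace 'rV[K]_#|X|} | (D <= C)%VS /\ \dim D = r]] w &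
    lbound [set #|code_support D| | D in
      [set D : {vspace 'rV[K]_#|X|} | (D <= C)%VS /\ \dim D = r]] w.
  (* The first [r] vectors of a basis of [C] span an admissible subcode, so the minimum is
     attained. *)
  apply: exists_least_nat; pose B := take r (vbasis C).
  exists #|code_support <<B>>%VS|, <<B>>%VS => //; split.
    by apply/span_subvP => v /mem_take/vbasis_mem.
  have : free B.
    by have := basis_free (vbasisP C); rewrite -(cat_take_drop r (vbasis C));
      move/catl_free.
  by move=> /eqP ->; rewrite size_takel // size_tuple.
rewrite /gen_hamming_weight (minimumE _ _ wmin); last by exists D0.
(* A monic basis of a subcode of least support is the candidate for the maximum. *)
subst r; have [f [Lf f1 finj D0E]] := exists_monic_basis hle hLsub hLstd D0C.
have wD := card_code_support X f; rewrite -D0E wE in wD.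
have degE F := quotient_degree_idealgen X F.
rewrite (@maximumE _ _ _ _ #|common_zeros X (range f)|%:R).
- by apply/esym/eqP; rewrite quotient_degree_vanishing subr_eq -natrD wD.
- exists (range f); last exact: degE.
  exists f; split=> // i; split=> //.
  by apply: contra_eq_neq (f1 i) => ->; rewrite /initcoef mcoeff0 eq_sym oner_neq0.
move=> _ [_ [g [-> gL ginj g1]] <-]; rewrite degE ler_nat.
have Lg i : L (g i) by case: (gL i).
(* Any other monic subset spans a subcode of support at least [w], hence has at most #|X| - [w]
   common zeros. *)
have gD := monic_span hle hLsub hLstd Lg g1 ginj.
have /wmin : [set #|code_support D| | D in
    [set D : {vspace 'rV[K]_#|X|} | (D <= C)%VS /\ \dim D = \dim D0]]
    #|code_support <<[tuple ev X (g i) | i < \dim D0]>>|.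
  by exists <<[tuple ev X (g i) | i < \dim D0]>>%VS.
rewrite leEnat => lew; rewrite -(leq_add2l w) wD.
by apply: leq_trans (eq_leq (card_code_support X g)); rewrite leq_add2r.
Qed.
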